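(* Let $\mathcal{C}$ be a monoidal category with coequalizers, and assume that the unit object $\underline{1}$ is a left $\otimes$-generator of $\mathcal{C}$ and that every object of $\mathcal{C}$ is right coflat. Let $i: R\to S$ be an algebra morphism in $\mathcal{C}$ with $S$ a left coflat object. Then the following assertions are equivalent: (i) The restriction of scalars functor $F:\mathcal{C}_S\to\mathcal{C}_R$ is a Frobenius functor. (ii) There exist an $R$-bimodule morphism $\vartheta: S\to R$ and a morphism $e:\underline{1}\to S\otimes_R S$ in $\mathcal{C}$ such that $$\mu^S_{S\otimes_RS}(\mathrm{Id}_S\otimes e)=\nu^S_{S\otimes_RS}(e\otimes \mathrm{Id}_S),\qquad \tilde{\vartheta}\,e=\Upsilon_S^{-1}\eta_S,\qquad \hat{\vartheta}\,e=\Upsilon'^{-1}_S\eta_S .$$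
   Context: Monoidal categories are taken strict, with tensor product $\otimes$ and unit object $\underline{1}$. For an algebra $A$ in $\mathcal{C}$, $m_A:A\otimes A\to A$ and $\eta_A:\underline{1}\to A$ are its multiplication and unit; $\mathcal{C}_A$, ${}_A\mathcal{C}$, ${}_A\mathcal{C}_A$ are the categories of right $A$-modules, left $A$-modules and $A$-bimodules in $\mathcal{C}$. An object $P$ of $\mathcal{C}$ is a left $\otimes$-generator of $\mathcal{C}$ if, whenever $f,g:Y\otimes Z\to W$ are morphisms in $\mathcal{C}$ with $f(\epsilon\otimes\mathrm{Id}_Z)=g(\epsilon\otimes\mathrm{Id}_Z)$ for all $\epsilon:P\to Y$ in $\mathcal{C}$, then $f=g$. An object $X$ is right (respectively left) coflat if the functor $X\otimes-$ (respectively $-\otimes X$) preserves coequalizers. For an algebra $R$, $X\in\mathcal{C}_R$ with action $\nu^R_X:X\otimes R\to X$ and $Y\in{}_R\mathcal{C}$ with action $\mu^R_Y:R\otimes Y\to Y$, $q^R_{X,Y}:X\otimes Y\to X\otimes_RY$ denotes the coequalizer of $\nu^R_X\otimes\mathrm{Id}_Y$ and $\mathrm{Id}_X\otimes\mu^R_Y$. For $g:X\to X'$ in $\mathcal{C}_R$, $\hat g:X\otimes_RY\to X'\otimes_RY$ is the unique morphism with $\hat g\,q^R_{X,Y}=q^R_{X',Y}(g\otimes\mathrm{Id}_Y)$; for $f:Y\to Y'$ in ${}_R\mathcal{C}$, $\tilde f:X\otimes_RY\to X\otimes_RY'$ is the unique morphism with $\tilde f\,q^R_{X,Y}=q^R_{X,Y'}(\mathrm{Id}_X\otimes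 f)$. $\Upsilon_X:X\otimes_RR\to X$ and $\Upsilon'_Y:R\otimes_RY\to Y$ are the isomorphisms determined by $\Upsilon_Xq^R_{X,R}=\nu^R_X$ and $\Upsilon'_Yq^R_{R,Y}=\mu^R_Y$. $S$ is an $R$-bimodule via $i$ and $m_S$. The object $S\otimes_RS$ is an $S$-bimodule with actions $\mu^S_{S\otimes_RS}:S\otimes(S\otimes_RS)\to S\otimes_RS$ and $\nu^S_{S\otimes_RS}:(S\otimes_RS)\otimes S\to S\otimes_RS$ determined by $\mu^S_{S\otimes_RS}(\mathrm{Id}_S\otimes q^R_{S,S})=q^R_{S,S}(m_S\otimes\mathrm{Id}_S)$ and $\nu^S_{S\otimes_RS}(q^R_{S,S}\otimes\mathrm{Id}_S)=q^R_{S,S}(\mathrm{Id}_S\otimes m_S)$. The restriction of scalars functor $F:\mathcal{C}_S\to\mathcal{C}_R$ sends a right $S$-module $(M,\nu^S_M)$ to $(M,\nu^S_M(\mathrm{Id}_M\otimes i))$ and is the identity on morphisms. A functor is called Frobenius if it has a right adjoint which is also a left adjoint. *)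

(* Defs.v *)
From Corelib Require Import ssreflect ssrfun ssrbool.
From Stdlib Require Import ClassicalEpsilon ProofIrrelevance.

Set Implicit Arguments.
Unset Strict Implicit.
Unset Printing Implicit Defensive.

Declare Scope cat_scope.
Delimit Scope cat_scope with cat.
Local Open Scope cat_scope.

Record category := Category {
  obj :> Type;
  hom : obj -> obj -> Type;
  idm : forall X : obj, hom X X;
  comp : forall X Y Z : obj, hom Y Z -> hom X Y -> hom X Z;
  comp_idl : forall (X Y : obj) (f : hom X Y), comp (idm Y) f = f;
  comp_idr : forall (X Y : obj) (f : hom X Y), comp f (idm X) = f;
  comp_assoc : forall (X Y Z W : obj) (h : hom Z W) (g : hom Y Z) (f : hom X Y),
    comp h (comp g f) = comp (comp h g) f }.

Arguments hom {c} X Y.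
Arguments idm {c} X.
Arguments comp {c X Y Z} g f.

Notation "g ∘ f" := (comp g f) (at level 40, left associativity) : cat_scope.

Record functor (C D : category) := Functor {
  fobj :> C -> D;
  fmap : forall X Y : C, hom X Y -> hom (fobj X) (fobj Y);
  fmap_id : forall X : C, fmap (idm X) = idm (fobj X);
  fmap_comp : forall (X Y Z : C) (g : hom Y Z) (f : hom X Y),
    fmap (g ∘ f) = fmap g ∘ fmap f }.

Arguments fmap {C D} _ {X Y} _.

Definition left_adjoint (C D : category) (F : functor C D) (G : functor D C) : Prop :=
  exists (u : forall X : C, hom X (G (F X))) (v : forall Y : D, hom (F (G Y)) Y),
    (forall (X X' : C) (f : hom X X'), u X' ∘ f = fmap G (fmap F f) ∘ u X) /\
    (forall (Y Y' : D) (g : hom Y Y'), g ∘ v Y = v Y' ∘ fmap F (fmap G g)) /\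
    (forall X : C, v (F X) ∘ fmap F (u X) = idm (F X)) /\
    (forall Y : D, fmap G (v Y) ∘ u (G Y) = idm (G Y)).

Definition is_frobenius (C D : category) (F : functor C D) : Prop :=
  exists G : functor D C, left_adjoint F G /\ left_adjoint G F.

Definition is_iso (C : category) (X Y : C) (f : hom X Y) : Prop :=
  exists g : hom Y X, g ∘ f = idm X /\ f ∘ g = idm Y.

Definition inverse (C : category) (X Y : C) (f : hom X Y) (H : is_iso f) : hom Y X :=
  proj1_sig (constructive_indefinite_description _ H).

Lemma inverse_spec (C : category) (X Y : C) (f : hom X Y) (H : is_iso f) :
  inverse H ∘ f = idm X /\ f ∘ inverse H = idm Y.
Proof. exact: (proj2_sig (constructive_indefinite_description _ H)). Qed.

Definition is_coequalizer (C : category) (X Y Q : C) (f g : hom X Y) (q : hom Y Q) : Prop :=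
  q ∘ f = q ∘ g /\
  forall (W : C) (h : hom Y W), h ∘ f = h ∘ g -> exists! k : hom Q W, k ∘ q = h.

Record coequalizer (C : category) (X Y : C) (f g : hom X Y) := Coequalizer {
  coeq_obj : C;
  coeq_map : hom Y coeq_obj;
  coeq_prop : is_coequalizer f g coeq_map }.

(* A choice of a coequalizer for every parallel pair. *)
Definition has_coequalizers (C : category) : Type :=
  forall (X Y : C) (f g : hom X Y), coequalizer f g.

Definition coeq_factor (C : category) (X Y Q : C) (f g : hom X Y) (q : hom Y Q)
    (H : is_coequalizer f g q) (W : C) (h : hom Y W) (E : h ∘ f = h ∘ g) : hom Q W :=
  proj1_sig (constructive_definite_description _ (proj2 H W h E)).

Lemma coeq_factorE (C : category) (X Y Q : C) (f g : hom X Y) (q : hom Y Q)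
    (H : is_coequalizer f g q) (W : C) (h : hom Y W) (E : h ∘ f = h ∘ g) :
  coeq_factor H E ∘ q = h.
Proof. exact: (proj2_sig (constructive_definite_description _ (proj2 H W h E))). Qed.

Lemma coeq_epi (C : category) (X Y Q : C) (f g : hom X Y) (q : hom Y Q)
    (H : is_coequalizer f g q) (W : C) (k k' : hom Q W) :
  k ∘ q = k' ∘ q -> k = k'.
Proof.
move=> e; case: H => Hq /(_ W (k' ∘ q)).
case; first by rewrite -!comp_assoc Hq.
by move=> l [_ u]; rewrite -(u _ e) -(u k').
Qed.

Definition preserves_coequalizers (C D : category) (F : functor C D) : Prop :=
  forall (X Y Q : C) (f g : hom X Y) (q : hom Y Q),
    is_coequalizer f g q -> is_coequalizer (fmap F f) (fmap F g) (fmap F q).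

(* Associativity and unitality of [tens] hold as equalities of objects; [idto]
   is the identity morphism, read along such an equality. *)
Definition idto (C : category) (X Y : C) (p : X = Y) : hom X Y :=
  match p with eq_refl => idm X end.

Record strict_monoidal := StrictMonoidal {
  mcat :> category;
  tens : mcat -> mcat -> mcat;
  tensm : forall X X' Y Y' : mcat,
    hom X X' -> hom Y Y' -> hom (tens X Y) (tens X' Y');
  unit_obj : mcat;
  tens_id : forall X Y : mcat, tensm (idm X) (idm Y) = idm (tens X Y);
  tens_comp : forall (X X' X'' Y Y' Y'' : mcat)
    (f' : hom X' X'') (f : hom X X') (g' : hom Y' Y'') (g : hom Y Y'),
    tensm (f' ∘ f) (g' ∘ g) = tensm f' g' ∘ tensm f g;
  tensA : forall X Y Z : mcat, tens (tens X Y) Z = tens X (tens Y Z);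
  tens1X : forall X : mcat, tens unit_obj X = X;
  tensX1 : forall X : mcat, tens X unit_obj = X;
  tensmA : forall (X X' Y Y' Z Z' : mcat)
    (f : hom X X') (g : hom Y Y') (h : hom Z Z'),
    idto (tensA X' Y' Z') ∘ tensm (tensm f g) h =
    tensm f (tensm g h) ∘ idto (tensA X Y Z);
  tensm1X : forall (X X' : mcat) (f : hom X X'),
    idto (tens1X X') ∘ tensm (idm unit_obj) f = f ∘ idto (tens1X X);
  tensmX1 : forall (X X' : mcat) (f : hom X X'),
    idto (tensX1 X') ∘ tensm f (idm unit_obj) = f ∘ idto (tensX1 X) }.

Arguments tens {s} X Y.
Arguments tensm {s X X' Y Y'} f g.
Arguments unit_obj {s}.

Notation "X ⊗ Y" := (tens X Y) (at level 34, left associativity) : cat_scope.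
Notation "f ⊠ g" := (tensm f g) (at level 34, left associativity) : cat_scope.
Notation "𝟙" := unit_obj (at level 0) : cat_scope.

(* The identities that the strict notation leaves implicit. *)
Definition assoc (C : strict_monoidal) (X Y Z : C) : hom ((X ⊗ Y) ⊗ Z) (X ⊗ (Y ⊗ Z)) :=
  idto (tensA X Y Z).
Definition assoc_inv (C : strict_monoidal) (X Y Z : C) : hom (X ⊗ (Y ⊗ Z)) ((X ⊗ Y) ⊗ Z) :=
  idto (eq_sym (tensA X Y Z)).
Definition lunit (C : strict_monoidal) (X : C) : hom (𝟙 ⊗ X) X := idto (tens1X X).
Definition lunit_inv (C : strict_monoidal) (X : C) : hom X (𝟙 ⊗ X) :=
  idto (eq_sym (tens1X X)).
Definition runit (C : strict_monoidal) (X : C) : hom (X ⊗ 𝟙) X := idto (tensX1 X).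
Definition runit_inv (C : strict_monoidal) (X : C) : hom X (X ⊗ 𝟙) :=
  idto (eq_sym (tensX1 X)).

Lemma idto_irr (C : category) (X Y : C) (p p' : X = Y) : idto p = idto p'.
Proof. by rewrite (proof_irrelevance _ p p'). Qed.

Lemma idto_id (C : category) (X : C) (p : X = X) : idto p = idm X.
Proof. exact (idto_irr p eq_refl). Qed.

Lemma idto_comp (C : category) (X Y Z : C) (p : Y = Z) (p' : X = Y) :
  idto p ∘ idto p' = idto (eq_trans p' p).
Proof. by destruct p, p'; rewrite /= comp_idl. Qed.

Lemma idto_tens (C : strict_monoidal) (X X' Y Y' : C) (p : X = X') (p' : Y = Y') :
  idto p ⊠ idto p' = idto (f_equal2 tens p p').
Proof. by destruct p, p'; rewrite /= tens_id idto_id. Qed.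

Lemma idto_tensl (C : strict_monoidal) (X X' Y : C) (p : X = X') :
  idto p ⊠ idm Y = idto (f_equal2 tens p (eq_refl Y)).
Proof. exact (idto_tens p (eq_refl Y)). Qed.

Lemma idto_tensr (C : strict_monoidal) (X Y Y' : C) (p : Y = Y') :
  idm X ⊠ idto p = idto (f_equal2 tens (eq_refl X) p).
Proof. exact (idto_tens (eq_refl X) p). Qed.

Lemma assocK (C : strict_monoidal) (X Y Z : C) :
  assoc_inv X Y Z ∘ assoc X Y Z = idm _.
Proof. by rewrite idto_comp idto_id. Qed.

Lemma assocKV (C : strict_monoidal) (X Y Z : C) :
  assoc X Y Z ∘ assoc_inv X Y Z = idm _.
Proof. by rewrite idto_comp idto_id. Qed.

Lemma lunitK (C : strict_monoidal) (X : C) : lunit_inv X ∘ lunit X = idm _.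
Proof. by rewrite idto_comp idto_id. Qed.

Lemma lunitKV (C : strict_monoidal) (X : C) : lunit X ∘ lunit_inv X = idm _.
Proof. by rewrite idto_comp idto_id. Qed.

Lemma runitK (C : strict_monoidal) (X : C) : runit_inv X ∘ runit X = idm _.
Proof. by rewrite idto_comp idto_id. Qed.

Lemma runitKV (C : strict_monoidal) (X : C) : runit X ∘ runit_inv X = idm _.
Proof. by rewrite idto_comp idto_id. Qed.

Lemma assoc_nat (C : strict_monoidal) (X X' Y Y' Z Z' : C)
    (f : hom X X') (g : hom Y Y') (h : hom Z Z') :
  assoc X' Y' Z' ∘ ((f ⊠ g) ⊠ h) = (f ⊠ (g ⊠ h)) ∘ assoc X Y Z.
Proof. exact: tensmA. Qed.

Lemma assoc_inv_nat (C : strict_monoidal) (X X' Y Y' Z Z' : C)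
    (f : hom X X') (g : hom Y Y') (h : hom Z Z') :
  assoc_inv X' Y' Z' ∘ (f ⊠ (g ⊠ h)) = ((f ⊠ g) ⊠ h) ∘ assoc_inv X Y Z.
Proof.
rewrite -[LHS]comp_idr -(assocKV X Y Z) comp_assoc -(comp_assoc _ _ (assoc _ _ _)).
by rewrite -assoc_nat comp_assoc assocK comp_idl.
Qed.

Lemma lunit_inv_nat (C : strict_monoidal) (X X' : C) (f : hom X X') :
  lunit_inv X' ∘ f = (idm 𝟙 ⊠ f) ∘ lunit_inv X.
Proof.
rewrite -[LHS]comp_idr -(lunitKV X) comp_assoc -(comp_assoc _ f) -tensm1X.
by rewrite comp_assoc lunitK comp_idl.
Qed.

Lemma runit_inv_nat (C : strict_monoidal) (X X' : C) (f : hom X X') :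
  runit_inv X' ∘ f = (f ⊠ idm 𝟙) ∘ runit_inv X.
Proof.
rewrite -[LHS]comp_idr -(runitKV X) comp_assoc -(comp_assoc _ f) -tensmX1.
by rewrite comp_assoc runitK comp_idl.
Qed.

Lemma tens_compl (C : strict_monoidal) (X X' X'' Y : C) (g : hom X' X'') (f : hom X X') :
  (g ∘ f) ⊠ idm Y = (g ⊠ idm Y) ∘ (f ⊠ idm Y).
Proof. by rewrite -tens_comp comp_idl. Qed.

Lemma tens_compr (C : strict_monoidal) (X Y Y' Y'' : C) (g : hom Y' Y'') (f : hom Y Y') :
  idm X ⊠ (g ∘ f) = (idm X ⊠ g) ∘ (idm X ⊠ f).
Proof. by rewrite -tens_comp comp_idl. Qed.

Lemma tens_swap (C : strict_monoidal) (X X' Y Y' : C) (f : hom X X') (g : hom Y Y') :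
  (f ⊠ idm Y') ∘ (idm X ⊠ g) = (idm X' ⊠ g) ∘ (f ⊠ idm Y).
Proof. by rewrite -!tens_comp !comp_idl !comp_idr. Qed.

Definition tens_left (C : strict_monoidal) (X : C) : functor C C :=
  @Functor C C (fun Y => X ⊗ Y) (fun Y Y' f => idm X ⊠ f)
    (fun Y => tens_id X Y) (fun Y Y' Y'' g f => tens_compr X g f).

Definition tens_right (C : strict_monoidal) (X : C) : functor C C :=
  @Functor C C (fun Y => Y ⊗ X) (fun Y Y' f => f ⊠ idm X)
    (fun Y => tens_id Y X) (fun Y Y' Y'' g f => tens_compl X g f).

Definition right_coflat (C : strict_monoidal) (X : C) : Prop :=
  preserves_coequalizers (tens_left X).

Definition left_coflat (C : strict_monoidal) (X : C) : Prop :=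
  preserves_coequalizers (tens_right X).

Definition left_tensor_generator (C : strict_monoidal) (P : C) : Prop :=
  forall (Y Z W : C) (f g : hom (Y ⊗ Z) W),
    (forall eps : hom P Y, f ∘ (eps ⊠ idm Z) = g ∘ (eps ⊠ idm Z)) -> f = g.

Record algebra (C : strict_monoidal) := Algebra {
  alg_obj :> C;
  mul : hom (alg_obj ⊗ alg_obj) alg_obj;
  one : hom 𝟙 alg_obj;
  mulA : mul ∘ (mul ⊠ idm alg_obj) = mul ∘ (idm alg_obj ⊠ mul) ∘ assoc _ _ _;
  mul1 : mul ∘ (one ⊠ idm alg_obj) = lunit alg_obj;
  mulx1 : mul ∘ (idm alg_obj ⊠ one) = runit alg_obj }.

Arguments mul {C} a.
Arguments one {C} a.

Record algebra_mor (C : strict_monoidal) (R S : algebra C) := AlgebraMor {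
  alg_mor :> hom (R : C) (S : C);
  alg_morM : alg_mor ∘ mul R = mul S ∘ (alg_mor ⊠ alg_mor);
  alg_mor1 : alg_mor ∘ one R = one S }.

Definition is_rmod (C : strict_monoidal) (A : algebra C) (M : C) (nu : hom (M ⊗ A) M) : Prop :=
  nu ∘ (nu ⊠ idm (A : C)) = nu ∘ (idm M ⊠ mul A) ∘ assoc _ _ _ /\
  nu ∘ (idm M ⊠ one A) = runit M.

Definition is_lmod (C : strict_monoidal) (A : algebra C) (M : C) (mu : hom (A ⊗ M) M) : Prop :=
  mu ∘ (mul A ⊠ idm M) = mu ∘ (idm (A : C) ⊠ mu) ∘ assoc _ _ _ /\
  mu ∘ (one A ⊠ idm M) = lunit M.

Record rmod (C : strict_monoidal) (A : algebra C) := RMod {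
  rmod_obj :> C;
  ract : hom (rmod_obj ⊗ A) rmod_obj;
  rmodP : is_rmod ract }.

Record lmod (C : strict_monoidal) (A : algebra C) := LMod {
  lmod_obj :> C;
  lact : hom (A ⊗ lmod_obj) lmod_obj;
  lmodP : is_lmod lact }.

Arguments ract {C A} r.
Arguments lact {C A} l.

Record bimod (C : strict_monoidal) (A : algebra C) := BiMod {
  bimod_obj : C;
  bi_lact : hom (A ⊗ bimod_obj) bimod_obj;
  bi_ract : hom (bimod_obj ⊗ A) bimod_obj;
  bi_lmodP : is_lmod bi_lact;
  bi_rmodP : is_rmod bi_ract;
  bi_compat : bi_ract ∘ (bi_lact ⊠ idm (A : C)) =
              bi_lact ∘ (idm (A : C) ⊠ bi_ract) ∘ assoc _ _ _ }.

Definition bimod_l (C : strict_monoidal) (A : algebra C) (M : bimod A) : lmod A :=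
  LMod (bi_lmodP M).
Definition bimod_r (C : strict_monoidal) (A : algebra C) (M : bimod A) : rmod A :=
  RMod (bi_rmodP M).

Coercion bimod_l : bimod >-> lmod.
Coercion bimod_r : bimod >-> rmod.

Record rmod_mor (C : strict_monoidal) (A : algebra C) (M N : rmod A) := RModMor {
  rmod_hom :> hom (M : C) (N : C);
  rmod_homP : rmod_hom ∘ ract M = ract N ∘ (rmod_hom ⊠ idm (A : C)) }.

Record lmod_mor (C : strict_monoidal) (A : algebra C) (M N : lmod A) := LModMor {
  lmod_hom :> hom (M : C) (N : C);
  lmod_homP : lmod_hom ∘ lact M = lact N ∘ (idm (A : C) ⊠ lmod_hom) }.

Record bimod_mor (C : strict_monoidal) (A : algebra C) (M N : bimod A) := BiModMor {
  bimod_hom : hom (bimod_obj M) (bimod_obj N);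
  bimod_homl : bimod_hom ∘ bi_lact M = bi_lact N ∘ (idm (A : C) ⊠ bimod_hom);
  bimod_homr : bimod_hom ∘ bi_ract M = bi_ract N ∘ (bimod_hom ⊠ idm (A : C)) }.

Definition bimod_mor_l (C : strict_monoidal) (A : algebra C) (M N : bimod A)
  (f : bimod_mor M N) : lmod_mor M N := @LModMor C A M N (bimod_hom f) (bimod_homl f).
Definition bimod_mor_r (C : strict_monoidal) (A : algebra C) (M N : bimod A)
  (f : bimod_mor M N) : rmod_mor M N := @RModMor C A M N (bimod_hom f) (bimod_homr f).

Coercion bimod_mor_l : bimod_mor >-> lmod_mor.
Coercion bimod_mor_r : bimod_mor >-> rmod_mor.

Lemma rmod_mor_eq (C : strict_monoidal) (A : algebra C) (M N : rmod A) (f g : rmod_mor M N) :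
  (f : hom (M : C) (N : C)) = g -> f = g.
Proof.
case: f g => [f pf] [g pg] /= e; case: g / e pg => pg.
by rewrite (proof_irrelevance _ pf pg).
Qed.

Lemma rmod_id_subproof (C : strict_monoidal) (A : algebra C) (M : rmod A) :
  idm (M : C) ∘ ract M = ract M ∘ (idm (M : C) ⊠ idm (A : C)).
Proof. by rewrite tens_id comp_idl comp_idr. Qed.

Definition rmod_id (C : strict_monoidal) (A : algebra C) (M : rmod A) : rmod_mor M M :=
  RModMor (rmod_id_subproof M).

Lemma rmod_comp_subproof (C : strict_monoidal) (A : algebra C) (M N P : rmod A)
    (g : rmod_mor N P) (f : rmod_mor M N) :
  (rmod_hom g ∘ rmod_hom f) ∘ ract M = ract P ∘ ((rmod_hom g ∘ rmod_hom f) ⊠ idm (A : C)).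
Proof.
by rewrite -comp_assoc rmod_homP comp_assoc rmod_homP -comp_assoc -tens_compl.
Qed.

Definition rmod_comp (C : strict_monoidal) (A : algebra C) (M N P : rmod A)
    (g : rmod_mor N P) (f : rmod_mor M N) : rmod_mor M P :=
  RModMor (rmod_comp_subproof g f).

Definition rmod_cat (C : strict_monoidal) (A : algebra C) : category :=
  @Category (rmod A) (@rmod_mor C A) (@rmod_id C A) (@rmod_comp C A)
    (fun M N f => rmod_mor_eq (f := rmod_comp (rmod_id N) f) (comp_idl (f : hom (M : C) (N : C))))
    (fun M N f => rmod_mor_eq (f := rmod_comp f (rmod_id M)) (comp_idr (f : hom (M : C) (N : C))))
    (fun M N P Q h g f => rmod_mor_eq
      (f := rmod_comp h (rmod_comp g f)) (g := rmod_comp (rmod_comp h g) f)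
      (comp_assoc (rmod_hom h) (rmod_hom g) (rmod_hom f))).

Definition regular (C : strict_monoidal) (A : algebra C) : bimod A :=
  @BiMod C A A (mul A) (mul A) (conj (mulA A) (mul1 A)) (conj (mulA A) (mulx1 A)) (mulA A).

Lemma restrict_rmodP (C : strict_monoidal) (R S : algebra C) (i : algebra_mor R S)
    (M : C) (nu : hom (M ⊗ S) M) :
  is_rmod nu -> is_rmod (A := R) (nu ∘ (idm M ⊠ i)).
Proof.
case=> a1 a2; split; last by rewrite -comp_assoc -tens_compr alg_mor1.
transitivity (nu ∘ (nu ⊠ idm (S : C)) ∘ ((idm M ⊠ i) ⊠ i)).
  by rewrite -!comp_assoc -!tens_comp !comp_idl !comp_idr.
rewrite a1 -!comp_assoc assoc_nat; congr (_ ∘ _).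
rewrite !comp_assoc; congr (_ ∘ _).
by rewrite -!tens_comp alg_morM !comp_idl.
Qed.

Lemma restrict_lmodP (C : strict_monoidal) (R S : algebra C) (i : algebra_mor R S)
    (M : C) (mu : hom (S ⊗ M) M) :
  is_lmod mu -> is_lmod (A := R) (mu ∘ (i ⊠ idm M)).
Proof.
case=> a1 a2; split; last by rewrite -comp_assoc -tens_compl alg_mor1.
rewrite -comp_assoc -tens_compl alg_morM tens_compl comp_assoc a1.
rewrite tens_compr -!comp_assoc assoc_nat; congr (_ ∘ _).
rewrite !comp_assoc; congr (_ ∘ _).
by rewrite -!tens_comp !comp_idl !comp_idr.
Qed.

Lemma restrict_compat (C : strict_monoidal) (R S : algebra C) (i : algebra_mor R S)
    (M : bimod S) :
  (bi_ract M ∘ (idm (bimod_obj M) ⊠ i)) ∘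
    ((bi_lact M ∘ (i ⊠ idm (bimod_obj M))) ⊠ idm (R : C)) =
  (bi_lact M ∘ (i ⊠ idm (bimod_obj M))) ∘
    (idm (R : C) ⊠ (bi_ract M ∘ (idm (bimod_obj M) ⊠ i))) ∘ assoc _ _ _.
Proof.
transitivity (bi_ract M ∘ (bi_lact M ⊠ idm (S : C)) ∘ ((i ⊠ idm (bimod_obj M)) ⊠ i)).
  rewrite -!comp_assoc; congr (_ ∘ _); rewrite -!tens_comp.
  by rewrite !comp_idl !comp_idr.
rewrite bi_compat -!comp_assoc assoc_nat; congr (_ ∘ _).
rewrite !comp_assoc; congr (_ ∘ _); rewrite -!tens_comp.
by rewrite !comp_idl !comp_idr.
Qed.

Definition restrict_rmod (C : strict_monoidal) (R S : algebra C) (i : algebra_mor R S)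
    (M : rmod S) : rmod R :=
  RMod (restrict_rmodP i (rmodP M)).

Definition restrict_bimod (C : strict_monoidal) (R S : algebra C) (i : algebra_mor R S)
    (M : bimod S) : bimod R :=
  BiMod (restrict_lmodP i (bi_lmodP M)) (restrict_rmodP i (bi_rmodP M)) (restrict_compat i M).

Lemma restrict_homP (C : strict_monoidal) (R S : algebra C) (i : algebra_mor R S)
    (M N : rmod S) (f : rmod_mor M N) :
  rmod_hom f ∘ ract (restrict_rmod i M) =
  ract (restrict_rmod i N) ∘ (rmod_hom f ⊠ idm (R : C)).
Proof. by rewrite /= comp_assoc rmod_homP -!comp_assoc tens_swap. Qed.

Definition restrict_mor (C : strict_monoidal) (R S : algebra C) (i : algebra_mor R S)
    (M N : rmod S) (f : rmod_mor M N) : rmod_mor (restrict_rmod i M) (restrict_rmod i N) :=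
  @RModMor C R (restrict_rmod i M) (restrict_rmod i N) f (restrict_homP i f).

Definition restriction (C : strict_monoidal) (R S : algebra C) (i : algebra_mor R S) :
    functor (rmod_cat S) (rmod_cat R) :=
  @Functor (rmod_cat S) (rmod_cat R) (restrict_rmod i) (restrict_mor i)
    (fun M => rmod_mor_eq (f := restrict_mor i (rmod_id M)) (g := rmod_id _) erefl)
    (fun M N P g f => rmod_mor_eq (f := restrict_mor i (rmod_comp g f))
       (g := rmod_comp (restrict_mor i g) (restrict_mor i f)) erefl).

Definition tens_over_coeq (C : strict_monoidal) (K : has_coequalizers C) (R : algebra C)
    (X : rmod R) (Y : lmod R) :=
  K _ _ (ract X ⊠ idm (Y : C)) ((idm (X : C) ⊠ lact Y) ∘ assoc (X : C) (R : C) (Y : C)).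

Definition tens_over (C : strict_monoidal) (K : has_coequalizers C) (R : algebra C)
    (X : rmod R) (Y : lmod R) : C :=
  coeq_obj (tens_over_coeq K X Y).

Definition tens_over_q (C : strict_monoidal) (K : has_coequalizers C) (R : algebra C)
    (X : rmod R) (Y : lmod R) : hom ((X : C) ⊗ (Y : C)) (tens_over K X Y) :=
  coeq_map (tens_over_coeq K X Y).

Lemma tens_over_qP (C : strict_monoidal) (K : has_coequalizers C) (R : algebra C)
    (X : rmod R) (Y : lmod R) :
  is_coequalizer (ract X ⊠ idm (Y : C)) ((idm (X : C) ⊠ lact Y) ∘ assoc (X : C) (R : C) (Y : C))
    (tens_over_q K X Y).
Proof. exact: coeq_prop. Qed.

Lemma hat_subproof (C : strict_monoidal) (K : has_coequalizers C) (R : algebra C)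
    (X X' : rmod R) (Y : lmod R) (g : rmod_mor X X') :
  (tens_over_q K X' Y ∘ (rmod_hom g ⊠ idm (Y : C))) ∘ (ract X ⊠ idm (Y : C)) =
  (tens_over_q K X' Y ∘ (rmod_hom g ⊠ idm (Y : C))) ∘
    ((idm (X : C) ⊠ lact Y) ∘ assoc (X : C) (R : C) (Y : C)).
Proof.
rewrite -comp_assoc -tens_compl rmod_homP tens_compl comp_assoc.
rewrite (proj1 (tens_over_qP K X' Y)) -!comp_assoc assoc_nat tens_id; congr (_ ∘ _).
by rewrite !comp_assoc tens_swap.
Qed.

Definition hat (C : strict_monoidal) (K : has_coequalizers C) (R : algebra C)
    (X X' : rmod R) (Y : lmod R) (g : rmod_mor X X') :
    hom (tens_over K X Y) (tens_over K X' Y) :=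
  coeq_factor (tens_over_qP K X Y) (hat_subproof K Y g).

Lemma tilde_subproof (C : strict_monoidal) (K : has_coequalizers C) (R : algebra C)
    (X : rmod R) (Y Y' : lmod R) (f : lmod_mor Y Y') :
  (tens_over_q K X Y' ∘ (idm (X : C) ⊠ lmod_hom f)) ∘ (ract X ⊠ idm (Y : C)) =
  (tens_over_q K X Y' ∘ (idm (X : C) ⊠ lmod_hom f)) ∘
    ((idm (X : C) ⊠ lact Y) ∘ assoc (X : C) (R : C) (Y : C)).
Proof.
rewrite -comp_assoc -tens_swap comp_assoc (proj1 (tens_over_qP K X Y')).
rewrite -!comp_assoc -[in LHS]tens_id assoc_nat; congr (_ ∘ _).
by rewrite !comp_assoc -!tens_compr lmod_homP.
Qed.

Definition tilde (C : strict_monoidal) (K : has_coequalizers C) (R : algebra C)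
    (X : rmod R) (Y Y' : lmod R) (f : lmod_mor Y Y') :
    hom (tens_over K X Y) (tens_over K X Y') :=
  coeq_factor (tens_over_qP K X Y) (tilde_subproof K X f).

Lemma Upsilon_subproof (C : strict_monoidal) (R : algebra C) (X : rmod R) :
  ract X ∘ (ract X ⊠ idm (R : C)) = ract X ∘ ((idm (X : C) ⊠ mul R) ∘ assoc _ _ _).
Proof. by rewrite comp_assoc; case: (rmodP X). Qed.

Definition Upsilon (C : strict_monoidal) (K : has_coequalizers C) (R : algebra C)
    (X : rmod R) : hom (tens_over K X (regular R)) (X : C) :=
  coeq_factor (tens_over_qP K X (regular R)) (Upsilon_subproof X).

Lemma Upsilon'_subproof (C : strict_monoidal) (R : algebra C) (Y : lmod R) :
  lact Y ∘ (mul R ⊠ idm (Y : C)) = lact Y ∘ ((idm (R : C) ⊠ lact Y) ∘ assoc _ _ _).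
Proof. by rewrite comp_assoc; case: (lmodP Y). Qed.

Definition Upsilon' (C : strict_monoidal) (K : has_coequalizers C) (R : algebra C)
    (Y : lmod R) : hom (tens_over K (regular R) Y) (Y : C) :=
  coeq_factor (tens_over_qP K (regular R) Y) (Upsilon'_subproof Y).

Lemma Upsilon_iso (C : strict_monoidal) (K : has_coequalizers C) (R : algebra C)
    (X : rmod R) : is_iso (Upsilon K X).
Proof.
have [_ a2] := rmodP X; pose q := tens_over_q K X (regular R).
have Eq : Upsilon K X ∘ q = ract X by exact: coeq_factorE.
exists (q ∘ (idm (X : C) ⊠ one R) ∘ runit_inv X); split; last first.
  by rewrite !comp_assoc Eq a2 runitKV.
apply: (coeq_epi (tens_over_qP K X (regular R))); rewrite -/q.
rewrite -comp_assoc Eq comp_idl -comp_assoc runit_inv_nat -!comp_assoc.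
rewrite (comp_assoc (idm (X : C) ⊠ one R)) -tens_swap comp_assoc.
rewrite (comp_assoc q) (proj1 (tens_over_qP K X (regular R))) -/q /=.
rewrite -!comp_assoc -[RHS]comp_idr; congr (_ ∘ _).
rewrite -(tens_id (X : C) (R : C)) (comp_assoc (assoc _ _ _)) assoc_nat !comp_assoc.
rewrite -tens_compr mulx1 -!comp_assoc /runit /assoc /runit_inv.
by rewrite idto_tensr !idto_comp idto_id tens_id.
Qed.

Lemma Upsilon'_iso (C : strict_monoidal) (K : has_coequalizers C) (R : algebra C)
    (Y : lmod R) : is_iso (Upsilon' K Y).
Proof.
have [_ a2] := lmodP Y; pose q := tens_over_q K (regular R) Y.
have Eq : Upsilon' K Y ∘ q = lact Y by exact: coeq_factorE.
have Hq : q ∘ (mul R ⊠ idm (Y : C)) ∘ assoc_inv _ _ _ = q ∘ (idm (R : C) ⊠ lact Y).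
  have := proj1 (tens_over_qP K (regular R) Y); rewrite -/q /= => ->.
  by rewrite -!comp_assoc assocKV comp_idr.
exists (q ∘ (one R ⊠ idm (Y : C)) ∘ lunit_inv Y); split; last first.
  by rewrite !comp_assoc Eq a2 lunitKV.
apply: (coeq_epi (tens_over_qP K (regular R) Y)); rewrite -/q.
rewrite -comp_assoc Eq comp_idl -comp_assoc lunit_inv_nat -!comp_assoc.
rewrite (comp_assoc (one R ⊠ idm (Y : C))) tens_swap !comp_assoc -Hq.
rewrite -!comp_assoc -[RHS]comp_idr; congr (_ ∘ _).
rewrite -(tens_id (R : C) (Y : C)) (comp_assoc (assoc_inv _ _ _)) assoc_inv_nat !comp_assoc.
rewrite -tens_compl mul1 -!comp_assoc /lunit /assoc_inv /lunit_inv.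
by rewrite idto_tensl !idto_comp idto_id tens_id.
Qed.

Definition alg_bimod (C : strict_monoidal) (R S : algebra C) (i : algebra_mor R S) : bimod R :=
  restrict_bimod i (regular S).

Definition SRS (C : strict_monoidal) (K : has_coequalizers C) (R S : algebra C)
    (i : algebra_mor R S) : C :=
  tens_over K (alg_bimod i) (alg_bimod i).

Definition SRS_q (C : strict_monoidal) (K : has_coequalizers C) (R S : algebra C)
    (i : algebra_mor R S) : hom ((S : C) ⊗ (S : C)) (SRS K i) :=
  tens_over_q K (alg_bimod i) (alg_bimod i).

Lemma SRS_lact_aux (C : strict_monoidal) (R S Q : C) (m : hom (S ⊗ S) S)
    (nu : hom (S ⊗ R) S) (mu : hom (R ⊗ S) S) (q : hom (S ⊗ S) Q) :
  q ∘ (nu ⊠ idm S) = q ∘ ((idm S ⊠ mu) ∘ assoc S R S) ->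
  m ∘ (idm S ⊠ nu) = nu ∘ (m ⊠ idm R) ∘ assoc_inv S S R ->
  (q ∘ (m ⊠ idm S) ∘ assoc_inv S S S) ∘ (idm S ⊠ (nu ⊠ idm S)) =
  (q ∘ (m ⊠ idm S) ∘ assoc_inv S S S) ∘ (idm S ⊠ ((idm S ⊠ mu) ∘ assoc S R S)).
Proof.
move=> Hq Hn.
rewrite -!comp_assoc assoc_inv_nat (comp_assoc (m ⊠ _)) -tens_compl Hn !tens_compl.
rewrite !comp_assoc Hq -!comp_assoc; congr (_ ∘ _).
rewrite (comp_assoc (assoc _ _ _)) assoc_nat tens_id tens_compr.
rewrite (comp_assoc (assoc_inv _ _ _)) assoc_inv_nat tens_id !comp_assoc.
rewrite tens_swap -!comp_assoc; do 2 congr (_ ∘ _).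
rewrite /assoc /assoc_inv idto_tensl idto_tensr !idto_comp; exact: idto_irr.
Qed.

Lemma SRS_lact_subproof (C : strict_monoidal) (K : has_coequalizers C) (R S : algebra C)
    (i : algebra_mor R S) :
  let f := ract (alg_bimod i) ⊠ idm (S : C) in
  let g := (idm (S : C) ⊠ lact (alg_bimod i)) ∘ assoc (S : C) (R : C) (S : C) in
  let h := SRS_q K i ∘ (mul S ⊠ idm (S : C)) ∘ assoc_inv _ _ _ in
  h ∘ (idm (S : C) ⊠ f) = h ∘ (idm (S : C) ⊠ g).
Proof.
apply: (SRS_lact_aux (proj1 (tens_over_qP K (alg_bimod i) (alg_bimod i)))) => /=.
rewrite -(comp_assoc _ _ (mul S ⊠ _)) -tens_swap tens_compr !comp_assoc mulA.
rewrite -!comp_assoc (comp_assoc (assoc _ _ _) _ _) -tens_id assoc_nat.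
by rewrite -(comp_assoc _ (assoc _ _ _)) assocKV comp_idr.
Qed.

(* Right (left) coflatness of [S] makes [idm S ⊠ SRS_q] ([SRS_q ⊠ idm S]) a
   coequalizer, so the left (right) action is determined by its composite with it. *)
Definition SRS_lact (C : strict_monoidal) (K : has_coequalizers C) (R S : algebra C)
    (i : algebra_mor R S) (HS : right_coflat (S : C)) : hom ((S : C) ⊗ SRS K i) (SRS K i) :=
  coeq_factor (HS _ _ _ _ _ _ (tens_over_qP K (alg_bimod i) (alg_bimod i)))
    (SRS_lact_subproof K i).

Lemma SRS_ract_aux (C : strict_monoidal) (R S Q : C) (m : hom (S ⊗ S) S)
    (nu : hom (S ⊗ R) S) (mu : hom (R ⊗ S) S) (q : hom (S ⊗ S) Q) :
  q ∘ (nu ⊠ idm S) = q ∘ ((idm S ⊠ mu) ∘ assoc S R S) ->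
  m ∘ (mu ⊠ idm S) = mu ∘ (idm R ⊠ m) ∘ assoc R S S ->
  (q ∘ (idm S ⊠ m) ∘ assoc S S S) ∘ ((nu ⊠ idm S) ⊠ idm S) =
  (q ∘ (idm S ⊠ m) ∘ assoc S S S) ∘ (((idm S ⊠ mu) ∘ assoc S R S) ⊠ idm S).
Proof.
move=> Hq Hn.
rewrite -!comp_assoc assoc_nat tens_id (comp_assoc (_ ⊠ m)) -tens_swap.
rewrite !comp_assoc Hq -!comp_assoc; congr (_ ∘ _).
rewrite tens_compl (comp_assoc (assoc _ _ _) (_ ⊠ mu ⊠ _)) assoc_nat !comp_assoc.
rewrite -tens_compr Hn !tens_compr -!comp_assoc; congr (_ ∘ _).
rewrite -(tens_id S R) (comp_assoc (assoc _ _ _)) assoc_nat -!comp_assoc.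
congr (_ ∘ _).
rewrite /assoc idto_tensl idto_tensr !idto_comp; exact: idto_irr.
Qed.

Lemma SRS_ract_subproof (C : strict_monoidal) (K : has_coequalizers C) (R S : algebra C)
    (i : algebra_mor R S) :
  let f := ract (alg_bimod i) ⊠ idm (S : C) in
  let g := (idm (S : C) ⊠ lact (alg_bimod i)) ∘ assoc (S : C) (R : C) (S : C) in
  let h := SRS_q K i ∘ (idm (S : C) ⊠ mul S) ∘ assoc _ _ _ in
  h ∘ (f ⊠ idm (S : C)) = h ∘ (g ⊠ idm (S : C)).
Proof.
apply: (SRS_ract_aux (proj1 (tens_over_qP K (alg_bimod i) (alg_bimod i)))) => /=.
rewrite -(comp_assoc _ _ (_ ⊠ mul S)) tens_swap tens_compl !comp_assoc mulA.
by rewrite -!comp_assoc assoc_nat tens_id.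
Qed.

Definition SRS_ract (C : strict_monoidal) (K : has_coequalizers C) (R S : algebra C)
    (i : algebra_mor R S) (HS : left_coflat (S : C)) : hom (SRS K i ⊗ (S : C)) (SRS K i) :=
  coeq_factor (HS _ _ _ _ _ _ (tens_over_qP K (alg_bimod i) (alg_bimod i)))
    (SRS_ract_subproof K i).

(* Main.v *)
(** Since the unit object generates, morphisms are determined by their values on
    "elements" [𝟙 -> X], and morphisms out of [X ⊗ Y] by their values on pairs of
    elements; every identity below is thus checked on elements, as over a ring.
    The functor [- ⊗_R S] is left adjoint to restriction, so restriction is Frobenius
    iff [- ⊗_R S] is also its right adjoint. From [theta] and [e] one gets the unit
    [n ↦ n e] and the counit [m ⊗ s ↦ m theta(s)]; conversely, [e] is the unit at [S]
    applied to [1], and [theta] is the counit at [R], the two missing linearities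
    following from naturality with respect to left multiplications by elements. *)

Require Import Defs.
From Stdlib Require Import ClassicalEpsilon.
From Corelib Require Import ssreflect ssrfun ssrbool.

Local Open Scope cat_scope.

Set Implicit Arguments.
Unset Strict Implicit.
Unset Printing Implicit Defensive.

(** * Uniqueness of left adjoints *)

Lemma adjoint_ext (C D : category) (F : functor C D) (T : functor D C)
    (u : forall M : D, hom M (F (T M))) (v : forall X : C, hom (T (F X)) X)
    (v_nat : forall (X Y : C) (g : hom X Y), g ∘ v X = v Y ∘ fmap T (fmap F g))
    (vu : forall M : D, v (T M) ∘ fmap T (u M) = idm (T M))
    (M : D) (X : C) (f g : hom (T M) X) :
  fmap F f ∘ u M = fmap F g ∘ u M -> f = g.
Proof.
(* [f] is recovered from its transpose as [v X ∘ fmap T (fmap F f ∘ u M)]. *)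
move=> fg; rewrite -[f]comp_idr -[g]comp_idr -vu !comp_assoc !v_nat.
by rewrite -!comp_assoc -!fmap_comp fg.
Qed.

(** [G] and [T], both left adjoint to [F], are isomorphic; the adjunction with [G] on the right is
    carried along this isomorphism. *)
Lemma left_adjoint_transport (C D : category) (F : functor C D) (G T : functor D C) :
  left_adjoint G F -> left_adjoint T F -> left_adjoint F G -> left_adjoint F T.
Proof.
move=> [uG [vG [uGn [vGn [GT1 GT2]]]]] [uT [vT [uTn [vTn [TT1 TT2]]]]].
move=> [u [v [un [vn [T1 T2]]]]].
(* The transposes of [uT] and [uG]; their compatibility with the units makes them mutually inverse
   by [adjoint_ext]. *)
pose a M := vG (T M) ∘ fmap G (uT M); pose b M := vT (G M) ∘ fmap T (uG M).
have aE M : fmap F (a M) ∘ uG M = uT M.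
  by rewrite fmap_comp -comp_assoc -uGn comp_assoc GT2 comp_idl.
have bE M : fmap F (b M) ∘ uT M = uG M.
  by rewrite fmap_comp -comp_assoc -uTn comp_assoc TT2 comp_idl.
have ab M : a M ∘ b M = idm (T M).
  apply: (adjoint_ext vTn TT1).
  by rewrite fmap_comp -comp_assoc bE aE fmap_id comp_idl.
have ba M : b M ∘ a M = idm (G M).
  apply: (adjoint_ext vGn GT1).
  by rewrite fmap_comp -comp_assoc aE bE fmap_id comp_idl.
have an M N (f : hom M N) : a N ∘ fmap G f = fmap T f ∘ a M.
  by rewrite /a -comp_assoc -fmap_comp uTn fmap_comp !comp_assoc -vGn.
have bn M N (f : hom M N) : b N ∘ fmap T f = fmap G f ∘ b M.
  by rewrite /b -comp_assoc -fmap_comp uGn fmap_comp !comp_assoc -vTn.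
clearbody a b; exists (fun X => a (F X) ∘ u X), (fun Y => v Y ∘ fmap F (b Y)).
split=> [X X' f|]; first by rewrite -comp_assoc un !comp_assoc an.
split=> [Y Y' g|]; first by rewrite comp_assoc vn -!comp_assoc -!fmap_comp bn.
split=> [X|Y].
  by rewrite -comp_assoc -fmap_comp (comp_assoc (b _)) ba comp_idl T1.
rewrite comp_assoc -an -comp_assoc fmap_comp -comp_assoc -un (comp_assoc _ (u _)).
by rewrite T2 comp_idl ab.
Qed.

(** * Calculus of elements [𝟙 -> X] *)

Section Elements.
Variable C : strict_monoidal.

(* Locked because rewriting with [comp_assoc] would otherwise unfold it. *)
Definition pair (X Y : C) (x : hom 𝟙 X) (y : hom 𝟙 Y) : hom 𝟙 (X ⊗ Y) :=
  locked ((x ⊠ y) ∘ lunit_inv 𝟙).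

Lemma tens_pair (X X' Y Y' : C) (f : hom X X') (g : hom Y Y') (x : hom 𝟙 X) (y : hom 𝟙 Y) :
  (f ⊠ g) ∘ pair x y = pair (f ∘ x) (g ∘ y).
Proof. by rewrite /pair -!lock comp_assoc -tens_comp. Qed.

Lemma assoc_pair (X Y Z : C) (x : hom 𝟙 X) (y : hom 𝟙 Y) (z : hom 𝟙 Z) :
  assoc X Y Z ∘ pair (pair x y) z = pair x (pair y z).
Proof.
rewrite /pair -!lock -{1}[z]comp_idr -{2}[x]comp_idr !tens_comp.
rewrite !comp_assoc assoc_nat -!comp_assoc; congr (_ ∘ _).
rewrite /assoc /lunit_inv idto_tensl idto_tensr !idto_comp; exact: idto_irr.
Qed.

Lemma lunit_pair (X : C) (x : hom 𝟙 X) : lunit X ∘ pair (idm 𝟙) x = x.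
Proof. by rewrite /pair -lock comp_assoc tensm1X -comp_assoc lunitKV comp_idr. Qed.

Lemma runit_pair (X : C) (x : hom 𝟙 X) : runit X ∘ pair x (idm 𝟙) = x.
Proof.
rewrite /pair -lock comp_assoc tensmX1 -comp_assoc idto_comp idto_id comp_idr //.
Qed.

Lemma runit_inv_pair (X : C) (x : hom 𝟙 X) : runit_inv X ∘ x = pair x (idm 𝟙).
Proof. by rewrite -{1}(runit_pair x) comp_assoc runitK comp_idl. Qed.

Lemma lunit_inv_pair (X : C) (x : hom 𝟙 X) : lunit_inv X ∘ x = pair (idm 𝟙) x.
Proof. by rewrite -{1}(lunit_pair x) comp_assoc lunitK comp_idl. Qed.

(** An element of [X ⊗ Y] need not be a pair, so an identity at such an element reduces to pairs
    only when both sides come from morphisms. The closure lemmas let [auto] supply this. *)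
Definition morphic (X Y : C) (f : hom 𝟙 X -> hom 𝟙 Y) : Prop :=
  exists h : hom X Y, forall x, f x = h ∘ x.

Lemma morphic_id (X : C) : morphic (fun x : hom 𝟙 X => x).
Proof. by exists (idm X) => x; rewrite comp_idl. Qed.

Lemma morphic_comp (X Y Z : C) (h : hom Y Z) (f : hom 𝟙 X -> hom 𝟙 Y) :
  morphic f -> morphic (fun x => h ∘ f x).
Proof. by case=> k kE; exists (h ∘ k) => x; rewrite kE comp_assoc. Qed.

Lemma morphic_pairl (X Y Z : C) (f : hom 𝟙 X -> hom 𝟙 Y) (z : hom 𝟙 Z) :
  morphic f -> morphic (fun x => pair (f x) z).
Proof.
case=> k kE; exists ((k ⊠ z) ∘ runit_inv X) => x.
by rewrite -comp_assoc runit_inv_pair tens_pair kE comp_idr.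
Qed.

Lemma morphic_pairr (X Y Z : C) (f : hom 𝟙 X -> hom 𝟙 Y) (z : hom 𝟙 Z) :
  morphic f -> morphic (fun x => pair z (f x)).
Proof.
case=> k kE; exists ((z ⊠ k) ∘ lunit_inv X) => x.
by rewrite -comp_assoc lunit_inv_pair tens_pair kE comp_idr.
Qed.

Hint Resolve morphic_id morphic_comp morphic_pairl morphic_pairr : core.

Definition evalE :=
  (tens_pair, assoc_pair, lunit_pair, runit_pair, runit_inv_pair, lunit_inv_pair, comp_idl).

Hypothesis unit_gen : left_tensor_generator (unit_obj : C).

(** The generator property speaks of sources [Y ⊗ Z]; take [Z = 𝟙] and cancel [runit]. *)
Lemma ext (X Y : C) (f g : hom X Y) : (forall x : hom 𝟙 X, f ∘ x = g ∘ x) -> f = g.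
Proof.
move=> fg; have fgr : f ∘ runit X = g ∘ runit X.
  apply: unit_gen => x; rewrite -!comp_assoc /runit tensmX1 !comp_assoc.
  by rewrite fg.
by rewrite -[f]comp_idr -[g]comp_idr -(runitKV X) !comp_assoc fgr.
Qed.

(** The generator property fixes the first component; what remains is a morphism out of [𝟙 ⊗ Y],
    reduced to [ext] by [lunit_inv]. *)
Lemma pair_ext (X Y Z : C) (f g : hom (X ⊗ Y) Z) :
  (forall (x : hom 𝟙 X) (y : hom 𝟙 Y), f ∘ pair x y = g ∘ pair x y) -> f = g.
Proof.
move=> fg; apply: unit_gen => x.
suff E : f ∘ (x ⊠ idm Y) ∘ lunit_inv Y = g ∘ (x ⊠ idm Y) ∘ lunit_inv Y.
  by rewrite -[LHS]comp_idr -[RHS]comp_idr -(lunitK Y) !comp_assoc E.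
by apply: ext => y; rewrite -!comp_assoc !evalE comp_idr.
Qed.

(** [pair_ext] would leave an arbitrary element of [𝟙] in the second slot; with the identity there,
    [runit_pair] applies. *)
Lemma runit_ext (X Y : C) (f g : hom (X ⊗ 𝟙) Y) :
  (forall x : hom 𝟙 X, f ∘ pair x (idm 𝟙) = g ∘ pair x (idm 𝟙)) -> f = g.
Proof.
move=> fg; rewrite -[f]comp_idr -[g]comp_idr -(runitK X) !comp_assoc; congr (_ ∘ _).
by apply: ext => x; rewrite -!comp_assoc runit_inv_pair.
Qed.

Lemma pair_elim (X Y Z : C) (f g : hom 𝟙 (X ⊗ Y) -> hom 𝟙 Z) :
  morphic f -> morphic g -> (forall x y, f (pair x y) = g (pair x y)) ->
  forall t, f t = g t.
Proof.
move=> [h hE] [k kE] fg t; rewrite hE kE; congr (_ ∘ _).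
by apply: pair_ext => x y; rewrite -hE -kE.
Qed.

Lemma pair3_ext (X Y Z W : C) (f g : hom ((X ⊗ Y) ⊗ Z) W) :
  (forall (x : hom 𝟙 X) (y : hom 𝟙 Y) (z : hom 𝟙 Z),
     f ∘ pair (pair x y) z = g ∘ pair (pair x y) z) -> f = g.
Proof.
move=> fg; apply: pair_ext => t z.
by move: t; apply: pair_elim; auto.
Qed.

Lemma pair3_elim (X Y Z W : C) (f g : hom 𝟙 ((X ⊗ Y) ⊗ Z) -> hom 𝟙 W) :
  morphic f -> morphic g ->
  (forall x y z, f (pair (pair x y) z) = g (pair (pair x y) z)) -> forall t, f t = g t.
Proof.
move=> [h hE] [k kE] fg t; rewrite hE kE; congr (_ ∘ _).
by apply: pair3_ext => x y z; rewrite -hE -kE.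
Qed.

(** * Module and algebra laws on elements *)

Lemma ract_ract (A : algebra C) (M : rmod A) (m : hom 𝟙 (M : C)) (a b : hom 𝟙 (A : C)) :
  ract M ∘ pair (ract M ∘ pair m a) b = ract M ∘ pair m (mul A ∘ pair a b).
Proof.
have [+ _] := rmodP M => /(congr1 (fun h => h ∘ pair (pair m a) b)).
by rewrite -!comp_assoc !evalE.
Qed.

Lemma ractx1 (A : algebra C) (M : rmod A) (m : hom 𝟙 (M : C)) :
  ract M ∘ pair m (one A) = m.
Proof.
have [_ +] := rmodP M => /(congr1 (fun h => h ∘ pair m (idm 𝟙))).
by rewrite -!comp_assoc !evalE comp_idr.
Qed.

Lemma mulA_el (A : algebra C) (a b c : hom 𝟙 (A : C)) :
  mul A ∘ pair (mul A ∘ pair a b) c = mul A ∘ pair a (mul A ∘ pair b c).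
Proof. exact: (ract_ract (M := regular A)). Qed.

Lemma mulx1_el (A : algebra C) (a : hom 𝟙 (A : C)) : mul A ∘ pair a (one A) = a.
Proof. exact: (ractx1 (M := regular A)). Qed.

Lemma mul1x_el (A : algebra C) (a : hom 𝟙 (A : C)) : mul A ∘ pair (one A) a = a.
Proof.
have /(congr1 (fun h => h ∘ pair (idm 𝟙) a)) := mul1 A.
by rewrite -!comp_assoc !evalE comp_idr.
Qed.

Lemma rmod_homE (A : algebra C) (M N : rmod A) (f : rmod_mor M N)
    (m : hom 𝟙 (M : C)) (a : hom 𝟙 (A : C)) :
  rmod_hom f ∘ (ract M ∘ pair m a) = ract N ∘ pair (rmod_hom f ∘ m) a.
Proof. by rewrite comp_assoc rmod_homP -comp_assoc !evalE. Qed.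

(** * Relative tensor products on elements *)

Variable K : has_coequalizers C.

Section TensOver.
Variables (A : algebra C) (X : rmod A) (Y : lmod A).

Definition tpair (x : hom 𝟙 (X : C)) (y : hom 𝟙 (Y : C)) : hom 𝟙 (tens_over K X Y) :=
  tens_over_q K X Y ∘ pair x y.

Lemma tpair_balanced (x : hom 𝟙 (X : C)) (a : hom 𝟙 (A : C)) (y : hom 𝟙 (Y : C)) :
  tpair (ract X ∘ pair x a) y = tpair x (lact Y ∘ pair a y).
Proof.
have [+ _] := tens_over_qP K X Y => /(congr1 (fun h => h ∘ pair (pair x a) y)).
by rewrite -!comp_assoc !evalE.
Qed.

Lemma tens_over_ext (Z : C) (f g : hom (tens_over K X Y) Z) :
  (forall x y, f ∘ tpair x y = g ∘ tpair x y) -> f = g.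
Proof.
move=> fg; apply: (coeq_epi (tens_over_qP K X Y)); apply: pair_ext => x y.
by rewrite -!comp_assoc fg.
Qed.

Lemma tens_over_elim (Z : C) (f g : hom 𝟙 (tens_over K X Y) -> hom 𝟙 Z) :
  morphic f -> morphic g -> (forall x y, f (tpair x y) = g (tpair x y)) ->
  forall t, f t = g t.
Proof.
move=> [h hE] [k kE] fg t; rewrite hE kE; congr (_ ∘ _).
by apply: tens_over_ext => x y; rewrite -hE -kE.
Qed.

Lemma tens_over_pair_ext (Z W : C) (f g : hom (tens_over K X Y ⊗ Z) W) :
  (forall x y z, f ∘ pair (tpair x y) z = g ∘ pair (tpair x y) z) -> f = g.
Proof.
move=> fg; apply: pair_ext => t z.
by move: t; apply: tens_over_elim; auto.
Qed.

End TensOver.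

Lemma hat_tpair (A : algebra C) (X X' : rmod A) (Y : lmod A) (g : rmod_mor X X')
    (x : hom 𝟙 (X : C)) (y : hom 𝟙 (Y : C)) :
  hat K Y g ∘ tpair x y = tpair (rmod_hom g ∘ x) y.
Proof. by rewrite comp_assoc coeq_factorE -comp_assoc !evalE. Qed.

Lemma tilde_tpair (A : algebra C) (X : rmod A) (Y Y' : lmod A) (f : lmod_mor Y Y')
    (x : hom 𝟙 (X : C)) (y : hom 𝟙 (Y : C)) :
  tilde K X f ∘ tpair x y = tpair x (lmod_hom f ∘ y).
Proof. by rewrite comp_assoc coeq_factorE -comp_assoc !evalE. Qed.

Lemma Upsilon_tpair (A : algebra C) (X : rmod A) (x : hom 𝟙 (X : C)) (a : hom 𝟙 (A : C)) :
  Upsilon K X ∘ tpair (Y := regular A) x a = ract X ∘ pair x a.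
Proof. by rewrite comp_assoc coeq_factorE. Qed.

Lemma Upsilon'_tpair (A : algebra C) (Y : lmod A) (a : hom 𝟙 (A : C)) (y : hom 𝟙 (Y : C)) :
  Upsilon' K Y ∘ tpair (X := regular A) a y = lact Y ∘ pair a y.
Proof. by rewrite comp_assoc coeq_factorE. Qed.

Lemma inverse_eq (X Y Z : C) (f : hom X Y) (H : is_iso f) (x : hom Z X) (y : hom Z Y) :
  x = inverse H ∘ y <-> f ∘ x = y.
Proof.
have [Hl Hr] := inverse_spec H; split=> [->|<-].
  by rewrite comp_assoc Hr comp_idl.
by rewrite comp_assoc Hl comp_idl.
Qed.

(** * Induction [- ⊗_R S] and its adjunction with restriction *)

Variables (R S : algebra C) (i : algebra_mor R S) (coflatS : left_coflat (S : C)).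

Lemma restrict_ractE (N : rmod S) (n : hom 𝟙 (N : C)) (r : hom 𝟙 (R : C)) :
  ract (restrict_rmod i N) ∘ pair n r = ract N ∘ pair n (i ∘ r).
Proof. by rewrite /= -comp_assoc !evalE. Qed.

Lemma alg_ractE (s : hom 𝟙 (S : C)) (r : hom 𝟙 (R : C)) :
  ract (alg_bimod i) ∘ pair s r = mul S ∘ pair s (i ∘ r).
Proof. by rewrite /= -comp_assoc !evalE. Qed.

Lemma alg_lactE (r : hom 𝟙 (R : C)) (s : hom 𝟙 (S : C)) :
  lact (alg_bimod i) ∘ pair r s = mul S ∘ pair (i ∘ r) s.
Proof. by rewrite /= -comp_assoc !evalE. Qed.

Definition ind_obj (M : rmod R) : C := tens_over K M (alg_bimod i).

Definition ind_pair (M : rmod R) (m : hom 𝟙 (M : C)) (s : hom 𝟙 (S : C)) :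
    hom 𝟙 (ind_obj M) :=
  tpair (Y := alg_bimod i) m s.

Lemma ind_balanced (M : rmod R)
    (m : hom 𝟙 (M : C)) (r : hom 𝟙 (R : C)) (s : hom 𝟙 (S : C)) :
  ind_pair (ract M ∘ pair m r) s = ind_pair m (mul S ∘ pair (i ∘ r) s).
Proof. by rewrite /ind_pair tpair_balanced alg_lactE. Qed.

(** Left multiplication by [i ∘ r] commutes with right multiplication by [s']. *)
Lemma ind_act_subproof (M : rmod R) :
  let h := tens_over_q K M (alg_bimod i) ∘ (idm (M : C) ⊠ mul S) ∘ assoc _ _ _ in
  h ∘ ((ract M ⊠ idm (S : C)) ⊠ idm (S : C)) =
  h ∘ (((idm (M : C) ⊠ lact (alg_bimod i)) ∘ assoc _ _ _) ⊠ idm (S : C)).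
Proof.
apply: pair_ext => t s'; move: t; apply: pair3_elim; auto => m r s.
rewrite -!comp_assoc !evalE -!comp_assoc !evalE.
by rewrite alg_lactE mulA_el; exact: ind_balanced.
Qed.

(** By [coflatS], tensoring the quotient map with [S] gives a coequalizer again, so the action may
    be prescribed before passing to the quotient. *)
Definition ind_act (M : rmod R) : hom (ind_obj M ⊗ S) (ind_obj M) :=
  coeq_factor (coflatS (tens_over_qP K M (alg_bimod i))) (ind_act_subproof M).

Lemma ind_actE (M : rmod R) (m : hom 𝟙 (M : C)) (s s' : hom 𝟙 (S : C)) :
  ind_act M ∘ pair (ind_pair m s) s' = ind_pair m (mul S ∘ pair s s').
Proof.
have -> : pair (ind_pair m s) s' =
    fmap (tens_right S) (tens_over_q K M (alg_bimod i)) ∘ pair (pair m s) s'.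
  by rewrite tens_pair comp_idl.
by rewrite comp_assoc coeq_factorE -!comp_assoc !evalE.
Qed.

Lemma ind_ext (M : rmod R) (Z : C) (f g : hom (ind_obj M) Z) :
  (forall m s, f ∘ ind_pair m s = g ∘ ind_pair m s) -> f = g.
Proof. exact: (tens_over_ext (Y := alg_bimod i)). Qed.

Lemma ind_elim (M : rmod R) (Z : C) (f g : hom 𝟙 (ind_obj M) -> hom 𝟙 Z) :
  morphic f -> morphic g -> (forall m s, f (ind_pair m s) = g (ind_pair m s)) ->
  forall t, f t = g t.
Proof. exact: (tens_over_elim (Y := alg_bimod i)). Qed.

Lemma ind_rmodP (M : rmod R) : is_rmod (ind_act M).
Proof.
split.
  apply: pair_ext => t s2; move: t; apply: pair_elim; auto => t s1; move: t.
  apply: ind_elim; auto => m s; rewrite -!comp_assoc !evalE.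
  by rewrite !ind_actE mulA_el.
apply: runit_ext => t; rewrite -!comp_assoc !evalE comp_idr.
by move: t; apply: ind_elim; auto => m s; rewrite ind_actE mulx1_el.
Qed.

Definition ind (M : rmod R) : rmod S := RMod (ind_rmodP M).

Lemma ind_ractE (M : rmod R) (m : hom 𝟙 (M : C)) (s s' : hom 𝟙 (S : C)) :
  ract (ind M) ∘ pair (ind_pair m s) s' = ind_pair m (mul S ∘ pair s s').
Proof. exact: ind_actE. Qed.

Lemma ind_morP (M N : rmod R) (f : rmod_mor M N) :
  hat K (alg_bimod i) f ∘ ract (ind M) = ract (ind N) ∘ (hat K (alg_bimod i) f ⊠ idm (S : C)).
Proof.
apply: tens_over_pair_ext => m s s'; rewrite -!comp_assoc !evalE.
by rewrite (hat_tpair (Y := alg_bimod i)) !ind_actE (hat_tpair (Y := alg_bimod i)).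
Qed.

Definition ind_mor (M N : rmod R) (f : rmod_mor M N) : rmod_mor (ind M) (ind N) :=
  @RModMor C S (ind M) (ind N) _ (ind_morP f).

Lemma ind_morE (M N : rmod R) (f : rmod_mor M N) (m : hom 𝟙 (M : C)) (s : hom 𝟙 (S : C)) :
  rmod_hom (ind_mor f) ∘ ind_pair m s = ind_pair (rmod_hom f ∘ m) s.
Proof. exact: hat_tpair. Qed.

Lemma ind_mor_id (M : rmod R) : ind_mor (rmod_id M) = rmod_id (ind M).
Proof. by apply: rmod_mor_eq; apply: ind_ext => m s; rewrite ind_morE !comp_idl. Qed.

Lemma ind_mor_comp (M N P : rmod R) (g : rmod_mor N P) (f : rmod_mor M N) :
  ind_mor (rmod_comp g f) = rmod_comp (ind_mor g) (ind_mor f).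
Proof.
by apply: rmod_mor_eq; apply: ind_ext => m s; rewrite -comp_assoc !ind_morE comp_assoc.
Qed.

Definition induction : functor (rmod_cat R) (rmod_cat S) :=
  @Functor (rmod_cat R) (rmod_cat S) ind ind_mor ind_mor_id ind_mor_comp.

(** Linearity is the relation [m r ⊗ 1 = m ⊗ i(r)]. Only the values on elements are exported; by
    [ext] they determine the morphism. *)
Lemma ind_unit_hom (M : rmod R) :
  exists u : rmod_mor M (restrict_rmod i (ind M)),
    forall m : hom 𝟙 (M : C), rmod_hom u ∘ m = ind_pair m (one S).
Proof.
have [h hE] : morphic (fun m : hom 𝟙 (M : C) => ind_pair m (one S)).
  by apply: morphic_comp; auto.
suff P : h ∘ ract M = ract (restrict_rmod i (ind M)) ∘ (h ⊠ idm (R : C)).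
  by exists (@RModMor C R M (restrict_rmod i (ind M)) _ P).
apply: pair_ext => m r; rewrite -!(comp_assoc _ _ (pair _ _)) !evalE -!hE.
by rewrite ind_balanced restrict_ractE ind_ractE mulx1_el mul1x_el.
Qed.

(** The map descends to the quotient because [(n i(r)) s = n (i(r) s)]. *)
Lemma ind_counit_hom (N : rmod S) :
  exists v : rmod_mor (ind (restrict_rmod i N)) N,
    forall (n : hom 𝟙 (N : C)) (s : hom 𝟙 (S : C)),
      rmod_hom v ∘ ind_pair (M := restrict_rmod i N) n s = ract N ∘ pair n s.
Proof.
have B : ract N ∘ (ract (restrict_rmod i N) ⊠ idm (S : C)) =
    ract N ∘ ((idm (N : C) ⊠ lact (alg_bimod i)) ∘ assoc _ _ _).
  apply: pair3_ext => n r s; rewrite -!comp_assoc !evalE alg_lactE.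
  by rewrite restrict_ractE ract_ract.
pose v := coeq_factor (tens_over_qP K (restrict_rmod i N) (alg_bimod i)) B.
have vE n s : v ∘ ind_pair (M := restrict_rmod i N) n s = ract N ∘ pair n s.
  by rewrite comp_assoc coeq_factorE.
suff P : v ∘ ract (ind (restrict_rmod i N)) = ract N ∘ (v ⊠ idm (S : C)).
  by exists (@RModMor C S (ind (restrict_rmod i N)) N _ P).
apply: tens_over_pair_ext => n s s'; rewrite -!comp_assoc !evalE.
by rewrite ind_ractE !vE ract_ract.
Qed.

(** Assembles morphisms obtained object by object into the families that [left_adjoint] asks for. *)
Lemma dependent_choice (A : Type) (B : A -> Type) (P : forall a, B a -> Prop) :
  (forall a, exists b, P a b) -> exists f : forall a, B a, forall a, P a (f a).
Proof.
move=> E; exists (fun a => proj1_sig (constructive_indefinite_description _ (E a))) => a.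
exact: (proj2_sig (constructive_indefinite_description _ (E a))).
Qed.

Lemma induction_left_adjoint : left_adjoint induction (restriction i).
Proof.
have [u uE] := dependent_choice ind_unit_hom.
have [v vE] := dependent_choice ind_counit_hom.
exists u, v; split=> [M M' f|].
  apply: rmod_mor_eq; apply: ext => m.
  by rewrite -!comp_assoc !uE ind_morE.
split=> [N N' g|].
  apply: rmod_mor_eq; apply: ind_ext => n s.
  by rewrite -!comp_assoc ind_morE !vE rmod_homE.
split=> [M|N].
  apply: rmod_mor_eq; apply: ind_ext => m s.
  by rewrite -!comp_assoc ind_morE !uE vE ind_ractE mul1x_el comp_idl.
apply: rmod_mor_eq; apply: ext => n.
by rewrite -!comp_assoc uE vE ractx1 comp_idl.
Qed.

(** Any two-sided adjoint is a left adjoint of restriction, hence isomorphic to [induction]. *)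
Lemma frobeniusP :
  is_frobenius (restriction i) <-> left_adjoint (restriction i) induction.
Proof.
split=> [[G [FG GF]]|FT].
  exact: left_adjoint_transport GF induction_left_adjoint FG.
by exists induction; split=> //; exact: induction_left_adjoint.
Qed.

(** [A] is free on its unit. Naturality against these morphisms later replaces linearity on the
    left. *)
Lemma rmod_point (A : algebra C) (N : rmod A) (n : hom 𝟙 (N : C)) :
  exists f : rmod_mor (regular A) N,
    forall a : hom 𝟙 (A : C), rmod_hom f ∘ a = ract N ∘ pair n a.
Proof.
have [h hE] : morphic (fun a : hom 𝟙 (A : C) => ract N ∘ pair n a) by auto.
suff P : h ∘ ract (regular A) = ract N ∘ (h ⊠ idm (A : C)).
  by exists (@RModMor C A (regular A) N _ P).
apply: pair_ext => a b; rewrite -!comp_assoc !evalE -!hE.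
by rewrite ract_ract.
Qed.

(** * The two actions on [S ⊗_R S], which is [ind_obj FS] by conversion *)

Local Notation FS := (restrict_rmod i (regular S)).

Lemma SRS_ractE (a b c : hom 𝟙 (S : C)) :
  SRS_ract K i coflatS ∘ pair (ind_pair (M := FS) a b) c =
  ind_pair (M := FS) a (mul S ∘ pair b c).
Proof.
have -> : pair (ind_pair (M := FS) a b) c =
    fmap (tens_right S) (tens_over_q K (alg_bimod i) (alg_bimod i)) ∘ pair (pair a b) c.
  by rewrite tens_pair comp_idl.
by rewrite comp_assoc coeq_factorE -!comp_assoc !evalE.
Qed.

Lemma SRS_lactE (coflatS' : right_coflat (S : C)) (a b c : hom 𝟙 (S : C)) :
  SRS_lact K i coflatS' ∘ pair c (ind_pair (M := FS) a b) =
  ind_pair (M := FS) (mul S ∘ pair c a) b.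
Proof.
have -> : pair c (ind_pair (M := FS) a b) =
    fmap (tens_left S) (tens_over_q K (alg_bimod i) (alg_bimod i)) ∘ pair c (pair a b).
  by rewrite tens_pair comp_idl.
rewrite comp_assoc coeq_factorE -!comp_assoc.
have -> : assoc_inv S S S ∘ pair c (pair a b) = pair (pair c a) b.
  by rewrite -assoc_pair comp_assoc assocK comp_idl.
by rewrite !evalE.
Qed.

Lemma SRS_ract_ind (z : hom 𝟙 (SRS K i)) (s : hom 𝟙 (S : C)) :
  SRS_ract K i coflatS ∘ pair z s = ract (ind FS) ∘ pair z s.
Proof.
congr (_ ∘ _); apply: tens_over_pair_ext => a b c.
by rewrite [LHS]SRS_ractE [RHS]ind_ractE.
Qed.

(** Left multiplication by [s] is right [S]-linear, so the left action of [s] is the image of a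
    morphism under induction, and naturality applies to it. *)
Lemma SRS_lact_ind (coflatS' : right_coflat (S : C)) (z : hom 𝟙 (SRS K i))
    (s : hom 𝟙 (S : C)) (f : rmod_mor (regular S) (regular S)) :
  (forall a, rmod_hom f ∘ a = mul S ∘ pair s a) ->
  SRS_lact K i coflatS' ∘ pair s z = rmod_hom (ind_mor (restrict_mor i f)) ∘ z.
Proof.
move=> fE; move: z; apply: tens_over_elim; auto => a b.
by rewrite [LHS]SRS_lactE [RHS]ind_morE fE.
Qed.

(** Gives a meaning to the product [n e]. Right coflatness of [N] lets the map descend from
    [N ⊗ (S ⊗ S)]. *)
Lemma coaction_hom (coflatC : forall X : C, right_coflat X) (N : rmod S) :
  exists act : hom (N ⊗ SRS K i) (ind_obj (restrict_rmod i N)),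
    forall (n : hom 𝟙 (N : C)) (a b : hom 𝟙 (S : C)),
      act ∘ pair n (ind_pair (M := FS) a b) =
      ind_pair (M := restrict_rmod i N) (ract N ∘ pair n a) b.
Proof.
pose q := tens_over_q K (restrict_rmod i N) (alg_bimod i).
pose h := q ∘ (ract N ⊠ idm (S : C)) ∘ assoc_inv _ _ _.
have hE n a b : h ∘ pair n (pair a b) =
    ind_pair (M := restrict_rmod i N) (ract N ∘ pair n a) b.
  by rewrite -assoc_pair -!comp_assoc (comp_assoc _ (assoc _ _ _)) assocK !evalE.
clearbody h; have B : h ∘ (idm (N : C) ⊠ (ract (alg_bimod i) ⊠ idm (S : C))) =
    h ∘ (idm (N : C) ⊠ ((idm (S : C) ⊠ lact (alg_bimod i)) ∘ assoc _ _ _)).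
  apply: pair_ext => n t; move: t; apply: pair3_elim; auto => a r b.
  rewrite -!comp_assoc !evalE -!comp_assoc !evalE !hE alg_lactE.
  by rewrite -ind_balanced restrict_ractE ract_ract.
exists (coeq_factor (coflatC _ _ _ _ _ _ _ (tens_over_qP K (alg_bimod i) (alg_bimod i))) B).
move=> n a b.
have -> : pair n (ind_pair (M := FS) a b) =
    fmap (tens_left N) (tens_over_q K (alg_bimod i) (alg_bimod i)) ∘ pair n (pair a b).
  by rewrite tens_pair comp_idl.
by rewrite comp_assoc coeq_factorE.
Qed.

(** * From [theta] and [e] to the adjunction *)

Lemma bimod_homrE (A : algebra C) (M N : bimod A) (f : bimod_mor M N)
    (m : hom 𝟙 (bimod_obj M)) (a : hom 𝟙 (A : C)) :
  bimod_hom f ∘ (bi_ract M ∘ pair m a) = bi_ract N ∘ pair (bimod_hom f ∘ m) a.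
Proof. by rewrite comp_assoc bimod_homr -comp_assoc !evalE. Qed.

Lemma frobenius_of_system (coflatC : forall X : C, right_coflat X)
    (theta : bimod_mor (alg_bimod i) (regular R)) (e : hom 𝟙 (SRS K i)) :
  (forall s, SRS_lact K i (coflatC S) ∘ pair s e = SRS_ract K i coflatS ∘ pair e s) ->
  Upsilon K (alg_bimod i) ∘ (tilde K (alg_bimod i) theta ∘ e) = one S ->
  Upsilon' K (alg_bimod i) ∘ (hat K (alg_bimod i) theta ∘ e) = one S ->
  left_adjoint (restriction i) induction.
Proof.
move=> eC e1 e2.
have [act actE] := dependent_choice (coaction_hom coflatC).
have act_sr N n s z : act N ∘ pair n (SRS_ract K i coflatS ∘ pair z s) =
    ract (ind (restrict_rmod i N)) ∘ pair (act N ∘ pair n z) s.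
  move: z; apply: (ind_elim (M := FS)); auto => a b.
  by rewrite SRS_ractE !actE ind_ractE.
have act_sl N n s z : act N ∘ pair n (SRS_lact K i (coflatC S) ∘ pair s z) =
    act N ∘ pair (ract N ∘ pair n s) z.
  move: z; apply: (ind_elim (M := FS)); auto => a b.
  by rewrite SRS_lactE !actE ract_ract.
have uex (N : rmod S) : exists u : rmod_mor N (ind (restrict_rmod i N)),
    forall n : hom 𝟙 (N : C), rmod_hom u ∘ n = act N ∘ pair n e.
  have [h hE] : morphic (fun n : hom 𝟙 (N : C) => act N ∘ pair n e) by auto.
  suff P : h ∘ ract N = ract (ind (restrict_rmod i N)) ∘ (h ⊠ idm (S : C)).
    by exists (@RModMor C S N (ind (restrict_rmod i N)) _ P).
  apply: pair_ext => n s; rewrite -!comp_assoc !evalE -!hE.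
  (* [(n e) s = n (e s) = n (s e) = (n s) e]. *)
  by rewrite -act_sr -eC act_sl.
have vex (M : rmod R) : exists v : rmod_mor (restrict_rmod i (ind M)) M,
    forall m s, rmod_hom v ∘ ind_pair m s = ract M ∘ pair m (bimod_hom theta ∘ s).
  (* Left linearity of [theta] makes [tilde] available; right linearity will make [v] linear. *)
  pose v := Upsilon K M ∘ tilde K M theta.
  have vE m s : v ∘ ind_pair m s = ract M ∘ pair m (bimod_hom theta ∘ s).
    by rewrite -comp_assoc tilde_tpair Upsilon_tpair.
  clearbody v; suff P : v ∘ ract (restrict_rmod i (ind M)) = ract M ∘ (v ⊠ idm (R : C)).
    by exists (@RModMor C R (restrict_rmod i (ind M)) M _ P).
  apply: pair_ext => t r; rewrite -!(comp_assoc _ _ (pair _ _)) !evalE.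
  move: t; apply: ind_elim; auto => m s.
  rewrite ind_ractE !vE ract_ract -(bimod_homrE theta).
  by rewrite (alg_ractE s r).
have [u uE] := dependent_choice uex; have [v vE] := dependent_choice vex.
exists u, v; split=> [N N' f|].
  apply: rmod_mor_eq; apply: ext => n.
  (* [e] need not be a pure tensor, but the identity holds for every element of [S ⊗_R S], so [e] is
     generalized and then tested on pure tensors. *)
  rewrite -!comp_assoc !uE; move: e {eC e1 e2 uex uE}; apply: (ind_elim (M := FS)); auto => a b.
  by rewrite !actE (ind_morE (restrict_mor i f)) -(rmod_homE f).
split=> [M M' f|].
  apply: rmod_mor_eq; apply: ind_ext => m s.
  by rewrite -!comp_assoc (ind_morE f) !vE rmod_homE.
split=> [N|M].
  (* On [z = a ⊗ b] both sides are [n a theta(b)]; at [z = e] this yields the first triangle. *)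
  have ve z n : rmod_hom (v (restrict_rmod i N)) ∘ (act N ∘ pair n z) =
      ract N ∘ pair n (Upsilon K (alg_bimod i) ∘ (tilde K (alg_bimod i) theta ∘ z)).
    move: z; apply: (ind_elim (M := FS)); auto => a b.
    by rewrite actE vE restrict_ractE ract_ract tilde_tpair Upsilon_tpair (alg_ractE a).
  apply: rmod_mor_eq; apply: ext => n.
  by rewrite -!comp_assoc uE ve e1 ractx1 comp_idl.
(* On [z = a ⊗ b] this reads [m theta(a) ⊗ b = m ⊗ i(theta(a)) b]. *)
have ve z m : rmod_hom (ind_mor (v M)) ∘ (act (ind M) ∘ pair (ind_pair m (one S)) z) =
    ind_pair m (Upsilon' K (alg_bimod i) ∘ (hat K (alg_bimod i) theta ∘ z)).
  move: z; apply: (ind_elim (M := FS)); [by auto|by apply: morphic_comp; auto|] => a b.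
  rewrite actE ind_ractE (ind_morE (v M)) vE mul1x_el hat_tpair Upsilon'_tpair.
  by rewrite ind_balanced (alg_lactE _ b).
apply: rmod_mor_eq; apply: ind_ext => m s.
(* Writing [m ⊗ s] as [(m ⊗ 1) s] and moving [s] across [e] reduces the second triangle to
   [s = 1]. *)
rewrite -!comp_assoc (uE (ind M)) comp_idl -{1}(mul1x_el s) -ind_ractE -act_sl eC act_sr.
by rewrite rmod_homE ve e2 ind_ractE mul1x_el.
Qed.

(** * From the adjunction to [theta] and [e] *)

Lemma system_of_frobenius (coflatS' : right_coflat (S : C)) :
  left_adjoint (restriction i) induction ->
  exists (theta : bimod_mor (alg_bimod i) (regular R)) (e : hom 𝟙 (SRS K i)),
    (forall s, SRS_lact K i coflatS' ∘ pair s e = SRS_ract K i coflatS ∘ pair e s) /\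
    Upsilon K (alg_bimod i) ∘ (tilde K (alg_bimod i) theta ∘ e) = one S /\
    Upsilon' K (alg_bimod i) ∘ (hat K (alg_bimod i) theta ∘ e) = one S.
Proof.
move=> [u [v [u_nat [v_nat [uv1 uv2]]]]].
(* Naturality and the triangle identities, evaluated on elements. *)
have unE (N N' : rmod S) (f : rmod_mor N N') (n : hom 𝟙 (N : C)) :
    rmod_hom (u N') ∘ (rmod_hom f ∘ n) =
    rmod_hom (ind_mor (restrict_mor i f)) ∘ (rmod_hom (u N) ∘ n).
  by rewrite !comp_assoc; exact: (congr1 (fun h => rmod_hom h ∘ n) (u_nat N N' f)).
have vnE (M M' : rmod R) (f : rmod_mor M M')
    (x : hom 𝟙 (restrict_rmod i (ind M) : C)) : rmod_hom f ∘ (rmod_hom (v M) ∘ x) =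
    rmod_hom (v M') ∘ (rmod_hom (ind_mor f) ∘ x).
  by rewrite !comp_assoc; exact: (congr1 (fun h => rmod_hom h ∘ x) (v_nat M M' f)).
have uvE (N : rmod S) (n : hom 𝟙 (N : C)) :
    rmod_hom (v (restrict_rmod i N)) ∘ (rmod_hom (u N) ∘ n) = n.
  rewrite comp_assoc -[RHS]comp_idl.
  exact: (congr1 (fun h => rmod_hom (M := restrict_rmod i N) h ∘ n) (uv1 N)).
have vuE (M : rmod R) (x : hom 𝟙 (ind M : C)) :
    rmod_hom (ind_mor (v M)) ∘ (rmod_hom (u (ind M)) ∘ x) = x.
  rewrite comp_assoc -[RHS]comp_idl.
  exact: (congr1 (fun h => rmod_hom h ∘ x) (uv2 M)).
have [h hE] : morphic (fun s => rmod_hom (v (bimod_r (regular R))) ∘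
    ind_pair (M := regular R) (one R) s).
  by apply: morphic_comp; apply: morphic_comp; auto.
have hl : h ∘ bi_lact (alg_bimod i) = bi_lact (regular R) ∘ (idm (R : C) ⊠ h).
  apply: pair_ext => r s; rewrite -!comp_assoc !evalE -!hE.
  (* [f] is left multiplication by [r]: naturality of [v] gives
     [r v(1 ⊗ s) = v(r ⊗ s) = v(1 ⊗ i(r) s)]. *)
  have [f fE] := rmod_point (N := regular R) r.
  transitivity (rmod_hom f ∘ (rmod_hom (v (bimod_r (regular R))) ∘
    ind_pair (M := regular R) (one R) s)); last exact: fE.
  rewrite (vnE _ _ f) (ind_morE f) fE mulx1_el.
  by rewrite -ind_balanced /= mul1x_el.
have hr : h ∘ bi_ract (alg_bimod i) = bi_ract (regular R) ∘ (h ⊠ idm (R : C)).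
  apply: pair_ext => s r; rewrite -!comp_assoc !evalE -!hE.
  rewrite -(rmod_homE (v (bimod_r (regular R)))) (restrict_ractE (N := ind (regular R))).
  by rewrite ind_ractE.
pose theta := @BiModMor C R (alg_bimod i) (regular R) h hl hr.
exists theta, (rmod_hom (u (bimod_r (regular S))) ∘ one S); split=> [s|].
  (* Both sides equal [u(s)]: [s e] by naturality against left multiplication by [s], [e s] by
     linearity of [u]. *)
  have [f fE] := rmod_point (N := regular S) s.
  rewrite (SRS_lact_ind _ _ fE) SRS_ract_ind -unE fE mulx1_el.
  by rewrite -(rmod_homE (u (bimod_r (regular S)))) mul1x_el.
split.
  (* By naturality of [v] along [r ↦ a i(r)], [a theta(b) = v(a ⊗ b)], so the claim is the first
     triangle at [S]. *)
  apply: etrans (uvE (regular S) (one S)); move: (rmod_hom (u (bimod_r (regular S))) ∘ one S).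
  apply: (ind_elim (M := FS)); auto => a b.
  rewrite tilde_tpair Upsilon_tpair /= -hE.
  have [f fE] := rmod_point (N := FS) a.
  rewrite -fE (vnE _ _ f) (ind_morE f) fE.
  by rewrite ractx1.
(* [f] is [a ↦ 1 ⊗ a] from [S] to [R ⊗_R S]. Through it [hat] of [theta] factors as
   [a ⊗ b ↦ (1 ⊗ a) ⊗ b ↦ theta(a) ⊗ b]. *)
have [f fE] := rmod_point (N := ind (regular R)) (ind_pair (M := regular R) (one R) (one S)).
have hatE (z : hom 𝟙 (SRS K i)) : hat K (alg_bimod i) theta ∘ z =
    rmod_hom (ind_mor (v (bimod_r (regular R)))) ∘ (rmod_hom (ind_mor (restrict_mor i f)) ∘ z).
  move: z; apply: (ind_elim (M := FS)); auto => a b.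
  rewrite hat_tpair (ind_morE (restrict_mor i f)) (ind_morE (v (bimod_r (regular R)))).
  by rewrite /= fE ind_ractE mul1x_el hE.
(* Naturality of [u] along [f] and the second triangle at [R] leave [f(1) = 1 ⊗ 1], which [Upsilon']
   sends to [i(1) = 1]. *)
rewrite hatE -unE vuE fE ind_ractE mulx1_el Upsilon'_tpair.
by rewrite alg_lactE alg_mor1 mulx1_el.
Qed.

End Elements.

Theorem theorem3p4 (C : strict_monoidal) (K : has_coequalizers C)
    (unit_gen : left_tensor_generator (unit_obj : C))
    (coflatC : forall X : C, right_coflat X)
    (R S : algebra C) (i : algebra_mor R S)
    (coflatS : left_coflat (S : C)) :
  is_frobenius (restriction i) <->
  exists (theta : bimod_mor (alg_bimod i) (regular R)) (e : hom (𝟙 : C) (SRS K i)),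
    SRS_lact K i (coflatC S) ∘ (idm (S : C) ⊠ e) ∘ runit_inv (S : C) =
    SRS_ract K i coflatS ∘ (e ⊠ idm (S : C)) ∘ lunit_inv (S : C) /\
    tilde K (alg_bimod i) theta ∘ e = inverse (Upsilon_iso K (alg_bimod i)) ∘ one S /\
    hat K (alg_bimod i) theta ∘ e = inverse (Upsilon'_iso K (alg_bimod i)) ∘ one S.
Proof.
(* It remains to pass between the equation of morphisms out of [S] and its values on elements, and
   to clear the inverses with [inverse_eq]. *)
rewrite (frobeniusP unit_gen K i coflatS); split.
  case/(system_of_frobenius (coflatC S)) => theta [e [eC [e1 e2]]].
  exists theta, e; split; last by split; apply/inverse_eq.
  apply: ext => // s; rewrite -!comp_assoc !evalE !comp_idr; exact: eC.
case=> theta [e [eC [/inverse_eq e1 /inverse_eq e2]]].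
apply: (frobenius_of_system unit_gen (coflatC := coflatC) _ e1 e2) => s.
have := congr1 (fun h => h ∘ s) eC.
by rewrite -!comp_assoc !evalE !comp_idr.
Qed.
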